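(* Let $R$ be a semiring. A set $M$ equipped with addition and scalar multiplication (over $R$) is a free $R$-semimodule (in the sense that there exists a set $J$ such that $M \cong R^J$) if and only if it is the standard notion of a free $R$-semimodule.
   Context: A semiring is a set $R$ with an addition and a multiplication that contains two elements $0$ and $1$ (which may coincide) such that for all $a,b,c \in R$: $a+0=a$; $a+(b+c)=(a+b)+c$; $a+b=b+a$; $1a=a=a1$; $a(bc)=(ab)c$; $a(b+c)=ab+ac$; $(a+b)c=ac+bc$; $0a=0=a0$. Multiplication is not assumed commutative. Elements of $R$ are called scalars. A set $X$ is equipped with addition and scalar multiplication if it comes with a map $X \times X \to X$, $(x,y) \mapsto x+y$, and a map $R \times X \to X$, $(a,x) \mapsto ax$ (also written $a \cdot x$). No axioms whatsoever are imposed on these two maps. For sets $X, Y$ equipped with addition and scalar multiplication, a map $f \colon X \to Y$ is linear if $f(x+y) = f(x)+f(y)$ for all $x,y \in X$ and $f(ax) = a \cdot f(x)$ for all $a \in R$, $x \in X$. An isomorphism is a linear map that is invertible as a map (there is a map $g \colon Y \to X$ with $g \circ f$ and $f \circ g$ identity maps). Write $X \cong Y$ if there is an isomorphism from $X$ to $Y$. For a set $J$, $R^J$ denotes the set of maps $s \colon J \to R$, $j \mapsto s_j$, such that the number of $j \in J$ with $s_j \neq 0$ is finite, equipped with pointwise addition $(s+t)_j = s_j + t_j$ and pointwise scalar multiplication $(as)_j = a \cdot s_j$. Free $R$-semimodule: a set $M$ equipped with addition and scalar multiplication is called a free $R$-semimodule if there exists a set $J$ such that $M \cong R^J$. Standard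 notion of an $R$-semimodule (left $R$-semimodule): a set $M$ equipped with addition and scalar multiplication that contains an element $\mathbf{0}$ such that for all $a,b \in R$ and $x,y,z \in M$: (1) $x + \mathbf{0} = x$; (2) $x+(y+z) = (x+y)+z$; (3) $x+y = y+x$; (4) $1x = x$; (5) $a(bx) = (ab)x$; (6) $a(x+y) = ax+ay$; (7) $(a+b)x = ax+bx$; (8) $0x = \mathbf{0} = a\mathbf{0}$. Standard notion of a free $R$-semimodule: a standard notion of an $R$-semimodule $M$ for which there exists a subset $Y$ of $M$ such that each $x \in M$ can be uniquely expressed in the form $x = \sum_{y \in Y} x_y \cdot y$, where each $x_y$ is in $R$ and the number of $y \in Y$ satisfying $x_y \neq 0$ is finite. *)

(* Defs.v *)
From HB Require Import structures.
From mathcomp Require Import all_boot all_order all_algebra.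
From mathcomp Require Import boolp classical_sets functions cardinality fsbigop.

Set Implicit Arguments.
Unset Strict Implicit.
Unset Printing Implicit Defensive.
Import GRing.Theory.
Local Open Scope classical_set_scope.
Local Open Scope ring_scope.

(* Throughout, [R : pzSemiRingType]: not necessarily commutative, and [0 = 1]
   is allowed. *)

(* No axioms are imposed on the two operations. *)
Record addScaleType (R : pzSemiRingType) := AddScaleType {
  carrier :> Type;
  vadd : carrier -> carrier -> carrier;
  vscale : R -> carrier -> carrier }.

Definition is_linear (R : pzSemiRingType) (X Y : addScaleType R) (f : X -> Y) :=
  (forall x y : X, f (vadd x y) = vadd (f x) (f y)) /\
  (forall (a : R) (x : X), f (vscale a x) = vscale a (f x)).

Definition isomorphic (R : pzSemiRingType) (X Y : addScaleType R) :=
  exists f : X -> Y, is_linear f /\ bijective f.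

Definition fin_supp (R : pzSemiRingType) (J : Type) (s : J -> R) :=
  finite_set [set j | s j <> 0].

(* The set R^J of finitely supported maps. *)
Definition fin_map (R : pzSemiRingType) (J : Type) := {s : J -> R | fin_supp s}.

Lemma fin_supp_add (R : pzSemiRingType) (J : Type) (s t : J -> R) :
  fin_supp s -> fin_supp t -> fin_supp (fun j => s j + t j).
Proof.
move=> fs ft.
apply: (@sub_finite_set _ _ ([set j | s j <> 0] `|` [set j | t j <> 0])).
  move=> j /= st; have [sj|sj] := pselect (s j = 0); last by left.
  by right=> tj; apply: st; rewrite sj tj addr0.
by rewrite finite_setU.
Qed.

Lemma fin_supp_scale (R : pzSemiRingType) (J : Type) (a : R) (s : J -> R) :
  fin_supp s -> fin_supp (fun j => a * s j).
Proof.
by apply: sub_finite_set => j /= asj sj; apply: asj; rewrite sj mulr0.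
Qed.

Definition fin_map_space (R : pzSemiRingType) (J : Type) : addScaleType R :=
  @AddScaleType R (fin_map R J)
    (fun s t => exist _ (fun j => sval s j + sval t j)
                        (fin_supp_add (svalP s) (svalP t)))
    (fun a s => exist _ (fun j => a * sval s j)
                        (fin_supp_scale a (svalP s))).

Definition is_free_semimodule (R : pzSemiRingType) (M : addScaleType R) :=
  exists J : Type, isomorphic M (fin_map_space R J).

Record is_std_semimodule (R : pzSemiRingType) (M : addScaleType R) (zero : M) :
    Prop := IsStdSemimodule {
  std_addv0 : forall x : M, vadd x zero = x;
  std_addvA : forall x y z : M, vadd x (vadd y z) = vadd (vadd x y) z;
  std_addvC : forall x y : M, vadd x y = vadd y x;
  std_scale1v : forall x : M, vscale 1 x = x;
  std_scalevA : forall (a b : R) (x : M), vscale a (vscale b x) = vscale (a * b) x;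
  std_scalevDr : forall (a : R) (x y : M),
    vscale a (vadd x y) = vadd (vscale a x) (vscale a y);
  std_scalevDl : forall (a b : R) (x : M),
    vscale (a + b) x = vadd (vscale a x) (vscale b x);
  std_scale0v : forall x : M, vscale 0 x = zero;
  std_scalev0 : forall a : R, vscale a zero = zero }.

(* The sum of the c_y y over y in Y. The finitely supported iterated operator
   ranges over the y with [vscale (c y) y <> zero]; these are among the
   finitely many y with [c y <> 0] as soon as [vscale 0 y = zero].
   [{classic Y}] is the subtype [Y], with classical decidable equality. *)
Definition lin_comb (R : pzSemiRingType) (M : addScaleType R) (zero : M)
    (Y : set M) (c : fin_map R Y) : M :=
  \big[@vadd R M/zero]_(y \in [set: {classic Y}]) vscale (sval c y) (\val y).

(* A coefficient family (x_y)_{y in Y} is an element of R^Y, so that uniqueness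
   only concerns the values on Y. *)
Definition is_std_free_semimodule (R : pzSemiRingType) (M : addScaleType R) :=
  exists zero : M, is_std_semimodule zero /\
  exists Y : set M, forall x : M, exists! c : fin_map R Y, x = lin_comb zero c.

(* Main.v *)
Require Import Defs.
From mathcomp Require Import all_boot all_order all_algebra.
From HB Require Import structures.
From mathcomp Require Import finmap boolp classical_sets functions cardinality.
From mathcomp Require Import fsbigop.

(** Both directions compare [M] with [R^J] through coordinates.

    If every element of [M] is [lin_comb] of exactly one coefficient family on
    [Y], then [lin_comb] is a bijection from [R^Y] to [M]; it is linear because
    the sum may be computed over any finite set containing the supports
    involved ([lin_combE]). Its inverse is the required isomorphism.

    Conversely, let [f : M -> R^J] be an isomorphism with inverse [g]. The
    semimodule axioms hold pointwise in [R^J] and are pulled back along the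
    injection [f]. The basis [Y] consists of the elements [g (fin_dirac j)], the
    preimages of the coordinate vectors: the linear functional
    [x |-> f x j] is 1 at the [j]-th basis element and 0 at the others, hence it
    reads the coefficient of that element off any linear combination
    ([lin_comb_dual]). So [x = lin_comb c] says exactly that [c] takes the value
    [f x j] at the [j]-th basis element, for every [j], and this determines [c].

    When [0 = 1] in [R], all the coordinate vectors coincide and the indexing of
    [Y] by [J] need not be injective. The argument covers this case too: it only
    uses that a family takes equal values at two indices of the same coordinate
    vector ([fin_dirac_eq]). *)

Set Implicit Arguments.
Unset Strict Implicit.
Unset Printing Implicit Defensive.
Import GRing.Theory.
Local Open Scope classical_set_scope.
Local Open Scope ring_scope.

Lemma fin_map_eq (R : pzSemiRingType) (J : Type) (s t : fin_map R J) :
  (forall j, sval s j = sval t j) -> s = t.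
Proof.
case: s t => [s fs] [t ft] /= st; have {}st : s = t by apply/funext.
by case: _ / st ft => ft; congr exist; exact: Prop_irrelevance.
Qed.

Definition fin_zero (R : pzSemiRingType) (J : Type) : fin_map R J.
Proof.
exists (fun=> 0).
by apply: (@sub_finite_set _ _ set0) => // j /=; exact.
Defined.

Definition fin_dirac (R : pzSemiRingType) (J : Type) (i : J) : fin_map R J.
Proof.
exists (fun j => `[< j = i >]%:R).
by apply: (@sub_finite_set _ _ [set i]) => // j /=; case: asboolP.
Defined.

(** Either the indices are equal, or comparing the two coordinate vectors at
    one of them gives [0 = 1], and then [R] is trivial. *)
Lemma fin_dirac_eq (R : pzSemiRingType) (J : Type) (i j : J) :
  fin_dirac R i = fin_dirac R j -> forall s : J -> R, s i = s j.
Proof.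
move=> /(congr1 (fun t : fin_map R J => sval t i)) /=.
rewrite asboolT//; case: asboolP => [-> //|_ /= R10 s].
have {}R10 : 1 = 0 :> R := R10.
by rewrite -(mul1r (s i)) -(mul1r (s j)) R10 !mul0r.
Qed.

(** Indexed by [{classic J}], because [{fset _}] requires a choice operator and
    [J] is an arbitrary type. *)
Definition fin_map_supp (R : pzSemiRingType) (J : Type) (s : fin_map R J) :
    {fset {classic J}} :=
  fset_set [set j : {classic J} | sval s j <> 0].

Lemma in_fin_map_supp (R : pzSemiRingType) (J : Type) (s : fin_map R J)
    (j : {classic J}) : sval s j <> 0 -> j \in fin_map_supp s.
Proof. by move=> sj; rewrite in_fset_set ?inE//; exact: (svalP s). Qed.

Lemma std_fin_map_space (R : pzSemiRingType) (J : Type) :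
  @is_std_semimodule R (fin_map_space R J) (fin_zero R J).
Proof.
split=> *; apply: fin_map_eq => j /=.
- exact: addr0.
- exact: addrA.
- exact: addrC.
- exact: mul1r.
- exact: mulrA.
- exact: mulrDr.
- exact: mulrDl.
- exact: mul0r.
- exact: mulr0.
Qed.

Lemma std_semimodule_inj (R : pzSemiRingType) (M N : addScaleType R)
    (f : M -> N) (zeroM : M) (zeroN : N) :
  is_linear f -> injective f -> f zeroM = zeroN ->
  is_std_semimodule zeroN -> is_std_semimodule zeroM.
Proof.
move=> [fD fZ] f_inj f0 [h1 h2 h3 h4 h5 h6 h7 h8 h9].
by split=> *; apply: f_inj; rewrite !(fD, fZ) ?f0.
Qed.

Lemma isomorphic_sym (R : pzSemiRingType) (X Y : addScaleType R) :
  isomorphic X Y -> isomorphic Y X.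
Proof.
move=> [f [[fD fZ] [g fK gK]]]; exists g; split; last by exists f.
by split=> *; apply: (can_inj fK); rewrite (fD, fZ) !gK.
Qed.

(** The addition of a semimodule, packaged so that the theory of iterated
    commutative operators applies to [lin_comb]. *)
Definition std_add_law (R : pzSemiRingType) (M : addScaleType R) (zero : M)
    (hM : is_std_semimodule zero) : Monoid.com_law zero :=
  HB.pack (@vadd R M)
    (Monoid.isComLaw.Build M zero (@vadd R M) (std_addvA hM) (std_addvC hM)
      (fun x => etrans (std_addvC hM zero x) (std_addv0 hM x))).

(** [lin_comb] ranges over the nonzero terms, which vary with the coefficients.
    Since terms with coefficient 0 vanish, the range can be enlarged to a fixed
    set, so that several linear combinations become sums over the same range. *)
Lemma lin_combE (R : pzSemiRingType) (M : addScaleType R) (zero : M)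
    (hM : is_std_semimodule zero) (Y : set M) (c : fin_map R Y)
    (A : {fset {classic Y}}) :
  (forall y : Y, sval c y <> 0 -> (y : {classic Y}) \in A) ->
  lin_comb zero c =
    \big[std_add_law hM/zero]_(y <- A) vscale (sval c y) (\val y).
Proof.
move=> cA; apply: (fsbigTE (op := std_add_law hM)) => y yA.
have [->|/cA] := pselect (sval c y = 0); first exact: std_scale0v.
by rewrite (negbTE yA).
Qed.

Lemma lin_comb_linear (R : pzSemiRingType) (M : addScaleType R) (zero : M)
    (Y : set M) : is_std_semimodule zero ->
  @is_linear R (fin_map_space R Y) M (@lin_comb R M zero Y).
Proof.
move=> hM; split=> [c d|a c].
- pose A := (fin_map_supp c `|` fin_map_supp d)%fset.
  have cA (y : {classic Y}) : sval c y <> 0 -> y \in A.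
    by move=> cy; rewrite /A in_fsetU (in_fin_map_supp cy).
  have dA (y : {classic Y}) : sval d y <> 0 -> y \in A.
    by move=> dy; rewrite /A in_fsetU (in_fin_map_supp dy) orbT.
  rewrite (lin_combE hM cA) (lin_combE hM dA) (@lin_combE _ _ _ hM _ _ A).
    rewrite -[RHS](big_split (std_add_law hM)).
    by apply: eq_bigr => y _; exact: (std_scalevDl hM).
  move=> y /= cdy; have [c0|/cA//] := pselect (sval c y = 0).
  by apply: dA => d0; apply: cdy; rewrite c0 d0 addr0.
- have cA := @in_fin_map_supp _ _ c.
  rewrite (lin_combE hM cA) (@lin_combE _ _ _ hM _ _ (fin_map_supp c)).
    rewrite (big_morph (vscale a) (std_scalevDr hM a) (std_scalev0 hM a)).
    by apply: eq_bigr => y _; rewrite (std_scalevA hM).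
  by move=> y /= acy; apply: cA => c0; apply: acy; rewrite c0 mulr0.
Qed.

(** Only the term of [y0] survives an additive and homogeneous [h] that is dual
    to [y0]. Such functionals make the coefficients of a linear combination
    unique. *)
Lemma lin_comb_dual (R : pzSemiRingType) (M : addScaleType R) (zero : M)
    (Y : set M) (h : M -> R) (y0 : Y) (c : fin_map R Y) :
  is_std_semimodule zero ->
  h zero = 0 -> {morph h : x y / vadd x y >-> x + y} ->
  (forall a x, h (vscale a x) = a * h x) ->
  h (\val y0) = 1 -> (forall y : Y, y <> y0 -> h (\val y) = 0) ->
  h (lin_comb zero c) = sval c y0.
Proof.
move=> hM h0 hD hZ h_y0 h_y.
(* [y0] is added to the support so that its term can always be isolated. *)
pose A := ((y0 : {classic Y}) |` fin_map_supp c)%fset.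
rewrite (@lin_combE _ _ _ hM _ c A); last first.
  by move=> y cy; rewrite /A in_fset1U (in_fin_map_supp cy) orbT.
rewrite (big_morph h hD h0).
rewrite (bigD1_seq (y0 : {classic Y}))/= ?fset1U1 ?fset_uniq//.
rewrite hZ h_y0 mulr1 big1 ?addr0// => y /eqP yy0.
by rewrite hZ h_y ?mulr0.
Qed.

Lemma std_free_free (R : pzSemiRingType) (M : addScaleType R) :
  is_std_free_semimodule M -> is_free_semimodule M.
Proof.
move=> [zero [hM [Y Yfree]]]; exists Y; apply: isomorphic_sym.
exists (@lin_comb R M zero Y); split; first exact: lin_comb_linear.
have [coord coordP] := choice Yfree.
exists coord => [c|x]; last by have [<-] := coordP x.
by have [_] := coordP (lin_comb zero c); exact.
Qed.

Lemma free_std_free (R : pzSemiRingType) (M : addScaleType R) :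
  is_free_semimodule M -> is_std_free_semimodule M.
Proof.
move=> [J [f [[fD fZ] [g fK gK]]]].
have hM : is_std_semimodule (g (fin_zero R J)).
  apply: (@std_semimodule_inj _ _ _ f _ _ (conj fD fZ) (can_inj fK) (gK _)).
  exact: std_fin_map_space.
exists (g (fin_zero R J)); split=> //.
pose e j : M := g (fin_dirac R j); pose Y := range e.
have eY j : e j \in Y by rewrite inE; exists j.
pose b j : Y := SigSub (eY j).
have [idx idxP] : {idx : Y -> J & forall y, b (idx y) = y}.
  apply: (@choice _ _ (fun y j => b j = y)) => y.
  have /set_mem[j _ ejy] := valP y.
  by exists j; apply: val_inj.
have b_eq i j : b i = b j -> forall s : J -> R, s i = s j.
  by move=> /(congr1 val)/(can_inj gK); exact: fin_dirac_eq.
have f_comb (c : fin_map R Y) j :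
    sval (f (lin_comb (g (fin_zero R J)) c)) j = sval c (b j).
  apply: (@lin_comb_dual _ _ _ _ (fun x => sval (f x) j)) => //=.
  - by rewrite gK.
  - by move=> x y; rewrite fD.
  - by move=> a x; rewrite fZ.
  - by rewrite gK /= asboolT.
  - move=> y; rewrite -(idxP y) /= gK /= => byj.
    by rewrite asboolF// => ji; apply: byj; rewrite ji.
exists Y => x.
(* The coefficient of a basis element is the coordinate at a chosen index. *)
have fin_c : fin_supp (fun y : Y => sval (f x) (idx y)).
  apply: (@finite_preimage _ _ [set j | sval (f x) j <> 0]).
    by move=> y z _ _ yz; rewrite -(idxP y) yz idxP.
  exact: (svalP (f x)).
exists (exist _ _ fin_c); split.
  apply: (can_inj fK); apply: fin_map_eq => j; rewrite f_comb /=.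
  by apply: b_eq; rewrite idxP.
move=> d xd; apply: fin_map_eq => y /=.
by rewrite {1}xd f_comb idxP.
Qed.

Theorem proposition3 (R : pzSemiRingType) (M : addScaleType R) :
  is_free_semimodule M <-> is_std_free_semimodule M.
Proof. by split; [exact: free_std_free | exact: std_free_free]. Qed.
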